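(* Let $f:\mathbb{R}^n\to\mathbb{R}$ have a nonempty set of global minimizers $\mathcal{X}^*$, let $x_0\in\mathbb{R}^n$, and let $S=\{x\in\mathbb{R}^n : \mathrm{dist}(x;\mathcal{X}^* )\le \mathrm{dist}(x_0;\mathcal{X}^* )\}$. Assume that $f$ is locally Lipschitz over $S$ and that its inverse condition number satisfies $\bar{\mu}>0$, where $$\bar{\mu}=\inf_{x^*\in\mathcal{X}^*,\ x\in S\setminus\mathcal{X}^*}\ \inf_{u\in\partial^\circ f(x)\setminus\{0\}}\frac{\langle u,x-x^*\rangle}{\|u\|\,\|x-x^*\|}.$$ Let $x^*\in\mathcal{X}^*$ be a minimizer, let $0<\beta\le 0.5$, let $R$ be a constant satisfying $$\beta\|x_0-x^*\|\le R\le(1-\beta)\|x_0-x^*\|,$$ and let $r$ satisfy $0<r\le\bar{\mu}$. Let the sequence $(x_t)$ be generated from $x_0$ as follows: for $t=0,1,2,\dots$, if $0\in\partial^\circ f(x_t)$ then stop; otherwise pick an arbitrary $g_t\in\partial^\circ f(x_t)$, set $$\eta_t=\frac{r\,\bigl(1+(\beta^2-2\beta)r^2\bigr)^{t/2}\,R}{\|g_t\|},\qquad x_{t+1}=x_t-\eta_t g_t .$$ Then every generated iterate $x_t$ satisfies $$\|x_t-x^*\|\le \bigl(1+(\beta^2-2\beta)r^2\bigr)^{t/2}\,\|x_0-x^*\|.$$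
   Context: $\|\cdot\|$ is the Euclidean norm and $\langle\cdot,\cdot\rangle$ the standard inner product on $\mathbb{R}^n$; $\mathrm{dist}(x;X)=\inf_{y\in X}\|x-y\|$. ''Locally Lipschitz over $S$'' means that every point of $S$ has an open neighborhood in $\mathbb{R}^n$ on which $f$ is Lipschitz. For $x\in S$, $\partial^\circ f(x)$ denotes the Clarke (generalized) subdifferential, i.e. $\partial^\circ f(x)=\{u\in\mathbb{R}^n : \langle u,v\rangle\le f^\circ(x;v)\ \forall v\in\mathbb{R}^n\}$ with $f^\circ(x;v)=\limsup_{y\to x,\ \lambda\downarrow 0}\frac{f(y+\lambda v)-f(y)}{\lambda}$. An infimum over an empty set is $+\infty$. *)

(* Defs.v *)
From HB Require Import structures.
From mathcomp Require Import all_boot all_order all_algebra.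
From mathcomp Require Import all_classical all_reals all_analysis.

Set Implicit Arguments.
Unset Strict Implicit.
Unset Printing Implicit Defensive.

Import Order.TTheory GRing.Theory Num.Theory.
Import numFieldNormedType.Exports.

Local Open Scope classical_set_scope.
Local Open Scope ring_scope.

Definition dotv (R : realType) (n : nat) (u v : 'rV[R]_n) : R :=
  \sum_(i < n) u ord0 i * v ord0 i.

(* The library norm `|u| on matrices is the sup norm; it induces the same
   topology as the Euclidean one, so nbhs and open below are the usual ones. *)
Definition enorm (R : realType) (n : nat) (u : 'rV[R]_n) : R :=
  Num.sqrt (dotv u u).

(* Extended-real valued, so that the infimum over the empty set is +oo. *)
Definition dist_set (R : realType) (n : nat) (x : 'rV[R]_n) (X : set 'rV[R]_n)
    : \bar R :=
  ereal_inf [set (enorm (x - y))%:E | y in X].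

Definition minimizers (R : realType) (n : nat) (f : 'rV[R]_n -> R)
    : set 'rV[R]_n :=
  [set x | forall y, f x <= f y].

Definition dist_sublevel (R : realType) (n : nat) (X : set 'rV[R]_n)
    (x0 : 'rV[R]_n) : set 'rV[R]_n :=
  [set x | (dist_set x X <= dist_set x0 X)%E].

(* The neighborhood U is open in the whole space, whereas the library's
   [locally [lipschitz f x | x in S]] only concerns the restriction to S. *)
Definition locally_lipschitz_over (R : realType) (n : nat)
    (f : 'rV[R]_n -> R) (S : set 'rV[R]_n) : Prop :=
  forall x, S x -> exists U : set 'rV[R]_n, [/\ open U, U x &
    exists L : R, forall y z, U y -> U z -> `|f y - f z| <= L * enorm (y - z)].

Definition clarke_dderiv (R : realType) (n : nat) (f : 'rV[R]_n -> R)
    (x v : 'rV[R]_n) : \bar R :=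
  limf_esup
    (fun p : 'rV[R]_n * R => ((f (p.1 + p.2 *: v) - f p.1) / p.2)%:E)
    (filter_prod (nbhs x) (0 : R)^'+).

Definition clarke_subdiff (R : realType) (n : nat) (f : 'rV[R]_n -> R)
    (x : 'rV[R]_n) : set 'rV[R]_n :=
  [set u | forall v, ((dotv u v)%:E <= clarke_dderiv f x v)%E].

Definition inv_condition_number (R : realType) (n : nat) (f : 'rV[R]_n -> R)
    (x0 : 'rV[R]_n) : \bar R :=
  let X := minimizers f in
  let S := dist_sublevel X x0 in
  ereal_inf
    [set ereal_inf [set (dotv u (x - xs) / (enorm u * enorm (x - xs)))%:E
                   | u in clarke_subdiff f x `\ (0 : 'rV[R]_n)]
    | xs in X & x in S `\` X].

Definition decay (R : realType) (beta r : R) (t : nat) : R :=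
  (1 + (beta ^+ 2 - 2 * beta) * r ^+ 2) `^ (t%:R / 2).

(* x 0, ..., x N are iterates generated by the method, with subgradients
   g 0, ..., g N.-1; the values of x beyond N and of g from N on are
   irrelevant. N is the number of steps considered: it need not be maximal,
   so both terminating and infinite executions are covered. *)
Definition subgradient_run (R : realType) (n : nat) (f : 'rV[R]_n -> R)
    (beta r radius : R) (x0 : 'rV[R]_n) (N : nat) (x g : nat -> 'rV[R]_n)
    : Prop :=
  x 0%N = x0 /\
  forall t : nat, (t < N)%N ->
    [/\ ~ clarke_subdiff f (x t) 0,
        clarke_subdiff f (x t) (g t) &
        x t.+1 = x t - (r * decay beta r t * radius / enorm (g t)) *: g t].

(* Main.v *)
Require Import Defs.
From mathcomp Require Import all_boot all_order all_algebra.
From mathcomp Require Import all_classical all_reals all_analysis.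
From mathcomp Require Import ring lra.
Import Order.TTheory GRing.Theory Num.Theory.
Import numFieldNormedType.Exports.
Local Open Scope classical_set_scope.
Local Open Scope ring_scope.

(** Write X for the set of minimizers, D for the distance from x0 to X and S
    for the closed D-neighborhood of X.  As long as the iterate x_t lies in S
    and is not a minimizer, its subgradient makes an angle of cosine at least r
    with x_t - xs, so that a step of length s gives
    |x_(t+1) - xs|^2 <= e^2 - 2 s r e + s^2   with e = |x_t - xs|.
    The right-hand side is convex in e, hence largest at the ends of
    [0, decay t * |x0 - xs|]; the bounds on the radius make both end values at
    most (decay (t+1) * |x0 - xs|)^2 (step_quadratic_bound).

    The difficulty is that xs is an arbitrary minimizer, not the one closest to
    x0, so that this estimate alone does not keep x_(t+1) in S.  What saves the
    argument is that a positive inverse condition number makes X very rigid.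

    - A minimizer p can be moved to p + v without leaving X whenever, along
      the whole segment, v points towards some fixed minimizer y up to a small
      angle (minimizers_shift).  Indeed, if f increased along the segment, a
      mean value inequality (subdiff_mean_value) would produce, at a
      non-minimizer close to the segment, a Clarke subgradient with positive
      component along v, which the cone condition at y forbids.
    - Hence X is convex (minimizers_convex).  Moreover, in dimension at least
      two, X is a single point or the whole space (minimizers_full): if z is
      the point of X nearest to x, then X lies in the half-space beyond z
      (nearest_minimizer_obtuse), whereas a second minimizer can be halved
      towards z and tilted towards x again and again until it leaves that
      half-space (no_sideways_minimizer).

    So if n >= 2 and the method makes a step, X = {xs} and the contraction
    estimate keeps the iterates in S.  If n <= 1, X is an interval: a step
    either stays on its side and approaches X, or lands in X, or jumps over X,
    and then the bound s <= |x0 - xs| limits the overshoot to D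
    (overshoot_bound).  The subgradients constructed along
    the way are proximal ones: they come from minimizing f plus a quadratic
    (proximal_clarke_subdiff). *)

(** * Euclidean geometry of row vectors *)

Section Euclidean.
Context {R : realType} {n : nat}.
Implicit Types (u v w : 'rV[R]_n) (a : R).

Lemma dotvC u v : dotv u v = dotv v u.
Proof. by apply: eq_bigr => i _; rewrite mulrC. Qed.

Lemma dotvDl u v w : dotv (u + v) w = dotv u w + dotv v w.
Proof. by rewrite -big_split; apply: eq_bigr => i _ /=; rewrite mxE mulrDl. Qed.

Lemma dotvZl a u v : dotv (a *: u) v = a * dotv u v.
Proof. by rewrite mulr_sumr; apply: eq_bigr => i _; rewrite mxE mulrA. Qed.

Lemma dotvNl u v : dotv (- u) v = - dotv u v.
Proof. by rewrite -scaleN1r dotvZl mulN1r. Qed.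

Lemma dotvDr u v w : dotv w (u + v) = dotv w u + dotv w v.
Proof. by rewrite !(dotvC w) dotvDl. Qed.

Lemma dotvZr a u v : dotv u (a *: v) = a * dotv u v.
Proof. by rewrite !(dotvC u) dotvZl. Qed.

Lemma dotvNr u v : dotv u (- v) = - dotv u v.
Proof. by rewrite !(dotvC u) dotvNl. Qed.

Lemma dotv0l u : dotv 0 u = 0.
Proof. by rewrite -(subrr u) dotvDl dotvNl subrr. Qed.

Lemma dotv0r u : dotv u 0 = 0.
Proof. by rewrite dotvC dotv0l. Qed.

Definition dotvE := (dotvDl, dotvDr, dotvNl, dotvNr, dotvZl, dotvZr).

Lemma dotv_sqrD u v :
  dotv (u + v) (u + v) = dotv u u + 2 * dotv u v + dotv v v.
Proof. by rewrite !dotvE (dotvC v u); ring. Qed.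

Lemma dotv_ge0 u : 0 <= dotv u u.
Proof. by apply: sumr_ge0 => i _; rewrite -expr2 sqr_ge0. Qed.

Lemma enorm_ge0 u : 0 <= enorm u.
Proof. exact: sqrtr_ge0. Qed.

Lemma enorm_sqr u : enorm u ^+ 2 = dotv u u.
Proof. by rewrite sqr_sqrtr ?dotv_ge0. Qed.

Lemma ltr_enorm u a : 0 <= a -> (enorm u < a) = (dotv u u < a ^+ 2).
Proof. by move=> a0; rewrite -enorm_sqr ltr_pXn2r ?nnegrE ?enorm_ge0. Qed.

Lemma ler_enorm u a : 0 <= a -> (enorm u <= a) = (dotv u u <= a ^+ 2).
Proof. by move=> a0; rewrite -enorm_sqr ler_pXn2r ?nnegrE ?enorm_ge0. Qed.

Lemma enorm0 : enorm (0 : 'rV[R]_n) = 0.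
Proof. by rewrite /enorm dotv0l sqrtr0. Qed.

Lemma coord_le_enorm u i : `|u ord0 i| <= enorm u.
Proof.
rewrite -(@ler_pXn2r _ 2) ?nnegrE ?enorm_ge0 // enorm_sqr.
rewrite real_normK ?num_real // /dotv (bigD1 i) //= -expr2 lerDl.
by apply: sumr_ge0 => j _; rewrite -expr2 sqr_ge0.
Qed.

Lemma enorm_eq0 u : (enorm u == 0) = (u == 0).
Proof.
apply/idP/eqP => [/eqP u0|->]; last by rewrite enorm0.
apply/rowP => i; rewrite mxE; apply/eqP; rewrite -normr_le0 -u0.
exact: coord_le_enorm.
Qed.

Lemma enorm_gt0 u : (0 < enorm u) = (u != 0).
Proof. by rewrite lt_def enorm_ge0 andbT enorm_eq0. Qed.

Lemma enormZ a u : enorm (a *: u) = `|a| * enorm u.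
Proof. by rewrite /enorm !dotvE mulrA -expr2 sqrtrM ?sqr_ge0 // sqrtr_sqr. Qed.

Lemma enormN u : enorm (- u) = enorm u.
Proof. by rewrite -scaleN1r enormZ normrN1 mul1r. Qed.

Lemma enormB u v : enorm (u - v) = enorm (v - u).
Proof. by rewrite -enormN opprB. Qed.

Lemma dotv_le_enorm u v : dotv u v <= enorm u * enorm v.
Proof.
have [->|v0] := eqVneq v 0.
  by rewrite enorm0 mulr0 dotv0r.
have v1 : 0 < enorm v by rewrite enorm_gt0.
have := dotv_ge0 (enorm v *: u - enorm u *: v).
have [u0|u0] := eqVneq u 0.
  by rewrite u0 enorm0 mul0r dotv0l.
have u1 : 0 < enorm u by rewrite enorm_gt0.
rewrite !dotvE (dotvC v u) -!enorm_sqr => h.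
suff : 0 <= (enorm u * enorm v) * (enorm u * enorm v - dotv u v).
  by rewrite pmulr_rge0 ?mulr_gt0 // subr_ge0.
nra.
Qed.

Lemma enormD u v : enorm (u + v) <= enorm u + enorm v.
Proof.
rewrite ler_enorm ?addr_ge0 ?enorm_ge0 // !dotvE (dotvC v u) -!enorm_sqr.
by have := dotv_le_enorm u v; nra.
Qed.

Lemma enormBD u v w : enorm (u - w) <= enorm (u - v) + enorm (v - w).
Proof. by apply: le_trans (enormD _ _); rewrite addrA subrK. Qed.

Lemma norm_le_enorm u : `|u| <= enorm u.
Proof.
rewrite [leLHS]/Num.norm /= mx_normrE; apply/bigmax_leP; split=> [|[i j] _] /=.
  exact: enorm_ge0.
by rewrite ord1 coord_le_enorm.
Qed.

End Euclidean.

Section Topology.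
Context {R : realType} {n : nat}.
Implicit Types (u v w x : 'rV[R]_n) (a : R).

Lemma cvg_dotv {T : Type} {H : set_system T} {FH : Filter H}
    (F G : T -> 'rV[R]_n) u v :
  F @ H --> u -> G @ H --> v -> dotv (F s) (G s) @[s --> H] --> dotv u v.
Proof.
move=> cF cG; rewrite /dotv.
have coord (E : T -> 'rV[R]_n) w i : E @ H --> w ->
    E s ord0 i @[s --> H] --> w ord0 i.
  move=> cE; apply: (@cvg_comp _ _ _ E (fun M : 'rV[R]_n => M ord0 i)) cE _.
  exact: coord_continuous.
elim: (index_enum _) => [|i r IH].
  by under eq_fun do rewrite big_nil; rewrite big_nil; exact: cvg_cst.
under eq_fun do rewrite big_cons; rewrite big_cons.
by apply: cvgD IH; apply: cvgM; exact: coord.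
Qed.

Lemma cvg_enorm {T : Type} {H : set_system T} {FH : Filter H}
    (F : T -> 'rV[R]_n) u : F @ H --> u -> enorm (F s) @[s --> H] --> enorm u.
Proof.
move=> cF; have cd : dotv (F s) (F s) @[s --> H] --> dotv u u.
  exact: cvg_dotv.
apply: (cvg_comp _ _ cd); exact: sqrt_continuous.
Qed.

(** The library topology is that of the sup norm; this lemma and the next let
    Euclidean balls serve as neighborhoods. *)
Lemma nbhs_eball x (B : set 'rV[R]_n) : nbhs x B ->
  exists2 e : R, 0 < e & forall z, enorm (z - x) < e -> B z.
Proof.
move=> /nbhs_ballP [e /= e0 eB]; exists e => // z ze; apply: eB.
rewrite -ball_normE /= distrC.
exact: le_lt_trans (norm_le_enorm _) ze.
Qed.

Lemma eball_nbhs x a : 0 < a -> nbhs x [set z | enorm (z - x) < a].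
Proof.
move=> a0.
have c : enorm (z - x) @[z --> x] --> enorm (x - x).
  apply: (@cvg_enorm _ (nbhs x) _ (fun z => z - x)).
  by apply: cvgB; [exact: cvg_id|exact: cvg_cst].
suff /c : nbhs (enorm (x - x)) [set y | y < a] by [].
by rewrite subrr enorm0; exact: lt_nbhsl.
Qed.

Lemma eball_compact x a : compact [set z | enorm (z - x) <= a].
Proof.
apply: bounded_closed_compact.
  exists (a + `|x|); split; first exact: num_real.
  move=> M aM z /= za; apply: le_trans (ltW aM).
  rewrite -[z](subrK x); apply: le_trans (ler_normD _ _) _.
  by rewrite lerD2r; apply: le_trans (norm_le_enorm _) za.
rewrite (_ : [set z | _] = (fun z => enorm (z - x)) @^-1` [set y | y <= a]) //.
apply: preimage_closed; last exact: closed_le.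
move=> z _; apply: (@cvg_enorm _ (nbhs z) _ (fun z => z - x)).
by apply: cvgB; [exact: cvg_id|exact: cvg_cst].
Qed.

End Topology.

(** * Clarke subgradients obtained by minimization *)

Section Clarke.
Context {R : realType} {n : nat}.
Implicit Types (f : 'rV[R]_n -> R) (u v w x : 'rV[R]_n) (a : R).

(** A quadratic minorant touching f at x bounds from below the difference
    quotients based at x itself, and these already bound the limsup that
    defines the Clarke derivative. *)
Lemma proximal_clarke_subdiff f x u (K e : R) : 0 < e -> 0 <= K ->
  (forall z, enorm (z - x) < e ->
     f x + dotv u (z - x) - K * dotv (z - x) (z - x) <= f z) ->
  clarke_subdiff f x u.
Proof.
move=> e0 K0 prox v; rewrite /clarke_dderiv limf_esupE.
apply: le_ereal_inf_tmp => _ [A [[V W] [/= nV nW] VWA] <-].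
apply/lee_subgt0Pr => eps eps0.
have [l [[l0 Wl] lv lK]] : exists l : R,
    [/\ 0 < l /\ W l, l * (enorm v + 1) < e & l * (K * dotv v v + 1) < eps].
  have v1 : 0 < enorm v + 1 by rewrite ltr_wpDl ?enorm_ge0.
  have v2 : 0 < K * dotv v v + 1 by rewrite ltr_wpDl ?mulr_ge0 ?dotv_ge0.
  near (0 : R)^'+ => l; exists l; split; first split.
  - by near: l; exact: nbhs_right_gt.
  - by near: l.
  - by rewrite -ltr_pdivlMr //; near: l; apply: nbhs_right_lt; rewrite divr_gt0.
  - by rewrite -ltr_pdivlMr //; near: l; apply: nbhs_right_lt; rewrite divr_gt0.
have Axl : A (x, l) by apply: VWA; split => //; exact: nbhs_singleton.
apply: le_trans (ereal_sup_ubound (ex_intro2 _ _ (x, l) Axl erefl)) => /=.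
rewrite lee_fin ler_pdivlMr //.
have xl : x + l *: v - x = l *: v by rewrite addrC addKr.
have := prox (x + l *: v); rewrite xl enormZ (gtr0_norm l0) !dotvE.
have ve := enorm_ge0 v.
move=> /(_ _)/wrap[]; first by nra.
nra.
Unshelve. all: by end_near. Qed.

Lemma minimizer_clarke_subdiff f x : minimizers f x -> clarke_subdiff f x 0.
Proof.
move=> fx; apply: (@proximal_clarke_subdiff _ _ _ 0 1) => // z _.
by rewrite dotv0l mul0r addr0 subr0.
Qed.

Lemma lipschitz_cvg f (U : set 'rV[R]_n) (L : R) x : open U -> U x ->
  (forall y z, U y -> U z -> `|f y - f z| <= L * enorm (y - z)) ->
  f z @[z --> x] --> f x.
Proof.
move=> oU Ux fL; apply/(@cvgrPdist_lt _ _ _ (nbhs x)) => eps eps0.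
have L1 : 0 < `|L| + 1 by rewrite ltr_wpDl.
near=> z.
have Uz : U z by near: z; exact: open_nbhs_nbhs.
have : enorm (z - x) < eps / (`|L| + 1).
  by near: z; apply: eball_nbhs; rewrite divr_gt0.
rewrite ltr_pdivlMr // => zx.
apply: le_lt_trans (fL _ _ Ux Uz) _; rewrite enormB.
by have := ler_norm L; have := enorm_ge0 (z - x); nra.
Unshelve. all: by end_near. Qed.

(** A nonsmooth mean value inequality.  The function
    f z + K |z - (p + t (q - p))|^2 - k t of (z, t) is minimized over
    a compact set: the large constant K keeps z close to the segment, and
    k < f q - f p keeps t away from 1.  Minimality in z makes
    u = -2K (z - (p + t (q - p))) a proximal subgradient, and minimality in t
    reads <u, q - p> >= k. *)
Lemma subdiff_mean_value f (m a : R) p q :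
  (forall z, m <= f z) ->
  (forall z, enorm (z - p) <= a -> f t @[t --> z] --> f z) ->
  2 * enorm (q - p) < a -> f p < f q ->
  exists x u,
    [/\ enorm (x - p) < a, clarke_subdiff f x u & 0 < dotv u (q - p)].
Proof.
move=> fm cf qpa fpq.
set v := q - p; pose k := (f q - f p) / 2.
have a0 : 0 < a by have := enorm_ge0 (q - p); lra.
have k0 : 0 < k by rewrite /k; lra.
have [b b0 fb] : exists2 b : R, 0 < b &
    forall z, enorm (z - q) < b -> f p + k < f z.
  have qa : enorm (q - p) <= a by have := enorm_ge0 (q - p); lra.
  have /cvgrPdist_lt /(_ _ k0) /nbhs_eball[b b0 hb] := cf q qa.
  by exists b => // z /hb; rewrite ltr_norml /k; lra.
pose c := Num.min b (a / 2).
have c0 : 0 < c by rewrite lt_min b0 divr_gt0.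
pose K := (f p - m + k + 1) / c ^+ 2.
have fpm := fm p.
have K0 : 0 < K by rewrite divr_gt0 ?exprn_gt0 //; lra.
pose A : set ('rV[R]_n * R) := [set z | enorm (z - p) <= a] `*` `[0, 1]%classic.
have [w wE] : exists w : 'rV[R]_n * R -> 'rV[R]_n,
    forall z, w z = z.1 - (p + z.2 *: v) by eexists.
pose G z := f z.1 + K * dotv (w z) (w z) - k * z.2.
have A0 : A !=set0.
  exists (p, 0); split; rewrite /= ?subrr ?enorm0 ?(ltW a0) //.
  by rewrite in_itv /= lexx ler01.
have cA : compact A.
  by apply: compact_setX; [exact: eball_compact|exact: segment_compact].
have cG : {within A, continuous G}.
  apply: continuous_in_subspaceT => -[z t] /set_mem[/= za _].
  have c1 : (fst : 'rV[R]_n * R -> _) @ (z, t) --> z by exact: cvg_fst.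
  have c2 : (snd : 'rV[R]_n * R -> _) @ (z, t) --> t by exact: cvg_snd.
  have cw : w @ (z, t) --> w (z, t).
    rewrite (_ : w = fun z => z.1 - (p + z.2 *: v)); last exact/funext.
    by apply: cvgB => //; apply: cvgD; [exact: cvg_cst|apply: cvgZr_tmp].
  apply: cvgB; last by apply: cvgM => //; exact: cvg_cst.
  apply: cvgD; first by apply: cvg_comp (cf z za).
  by apply: cvgM; [exact: cvg_cst|exact: cvg_dotv].
have [[x t] /set_mem[/= xa]] := compact_EVT_min A0 cA cG.
rewrite in_itv /= => /andP[t0 t1] Gmin.
have Gle z s : enorm (z - p) <= a -> 0 <= s <= 1 -> G (x, t) <= G (z, s).
  by move=> za s01; apply: Gmin; apply/mem_set; split => //=; rewrite in_itv.
have Gp : G (x, t) <= f p.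
  apply: le_trans (Gle p 0 _ _) _; rewrite ?subrr ?enorm0 ?(ltW a0) ?lexx ?ler01 //.
  by rewrite /G wE /= scale0r addr0 subrr dotv0l !mulr0 addr0 subr0.
have Kc : K * c ^+ 2 = f p - m + k + 1 by rewrite /K mulfVK // expf_neq0 // gt_eqF.
have wc : enorm (w (x, t)) < c.
  rewrite ltr_enorm ?(ltW c0) // -(ltr_pM2l K0) Kc.
  by move: Gp; rewrite /G /=; have := fm x; nra.
have t1' : t < 1.
  rewrite lt_neqAle t1 andbT; apply/eqP => te.
  have : enorm (x - q) < b.
    move: wc; rewrite wE /= te scale1r /v (addrC p) subrK => h.
    by apply: lt_le_trans h _; rewrite ge_min lexx.
  move=> /fb; move: Gp; rewrite /G /= te.
  have := dotv_ge0 (w (x, 1)); nra.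
have xa' : enorm (x - p) < a.
  have -> : x - p = w (x, t) + t *: v by rewrite !wE /= opprD addrA subrK.
  apply: le_lt_trans (enormD _ _) _; rewrite enormZ ger0_norm //.
  have : c <= a / 2 by rewrite ge_min lexx orbT.
  by have := enorm_ge0 v; rewrite -/v in qpa; nra.
exists x, (- (2 * K) *: w (x, t)); split => //.
  have e0 : 0 < a - enorm (x - p) by lra.
  apply: (@proximal_clarke_subdiff _ _ _ K _ e0 (ltW K0)) => z ze.
  have za : enorm (z - p) <= a.
    by apply: le_trans (enormBD z x p) _; lra.
  have := Gle z t za; rewrite t0 t1 => /(_ isT).
  have wz : w (z, t) = w (x, t) + (z - x) by rewrite !wE /= [RHS]addrC addrA subrK.
  rewrite /G /= wz; rewrite dotv_sqrD dotvZl; lra.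
(* Were <u, v> <= 0, increasing t slightly would decrease G, as t < 1. *)
rewrite -/v.
set d := dotv _ _; rewrite ltNge; apply/negP => d0.
pose V := dotv v v + 1.
have V0 : 0 < V by rewrite ltr_wpDl ?dotv_ge0.
pose s := Num.min (1 - t) (k / (K * V + 1)).
have KV : 0 < K * V + 1 by rewrite ltr_wpDl // mulr_ge0 // ltW.
have s0 : 0 < s by rewrite lt_min subr_gt0 t1' divr_gt0.
have s1 : s <= 1 - t by rewrite ge_min lexx.
have sk : s * (K * V + 1) <= k by rewrite -ler_pdivlMr // ge_min lexx orbT.
have := Gle x (t + s) xa; move=> /(_ _)/wrap[]; first by lra.
rewrite /G /= (_ : w (x, t + s) = w (x, t) - s *: v); last first.
  by rewrite !wE /= scalerDl !opprD !addrA.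
rewrite dotv_sqrD !(dotvNr, dotvNl, dotvZr, dotvZl) => h.
have wv : 0 <= dotv (w (x, t)) v * K by move: d0; rewrite /d dotvZl; lra.
have := dotv_ge0 v; rewrite /V in sk.
nra.
Qed.

End Clarke.

(** * Motions that preserve the set of minimizers *)

(** The last point at which h takes the value (h 0 + h 1) / 2.  Working near it
    localizes an increase of f along a segment around a single point where f is
    already above its minimum, so that no compactness argument along the
    segment is needed. *)
Lemma last_crossing (R : realType) (h : R -> R) :
  (forall t : R, 0 <= t <= 1 -> h s @[s --> t] --> h t) -> h 0 < h 1 ->
  exists t0, [/\ 0 <= t0 < 1, h 0 < h t0 & forall t, t0 < t <= 1 -> h t0 < h t].
Proof.
move=> ch h01; pose c := (h 0 + h 1) / 2.
pose E := [set t : R | 0 <= t <= 1 /\ h t <= c].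
have E0 : E 0 by split; rewrite ?lexx ?ler01 // /c; lra.
have hE : has_sup E by split; [exists 0|exists 1 => t [/andP[]]].
pose t0 := sup E.
have t00 : 0 <= t0 by exact: sup_upper_bound.
have t01 : t0 <= 1 by apply: sup_le_ub; [exists 0|move=> t [/andP[]]].
have ct0 : h s @[s --> t0] --> h t0 by apply: ch; rewrite t00.
have above t : t0 < t <= 1 -> c < h t.
  move=> /andP[t0t t1]; rewrite ltNge; apply/negP => htc.
  have : t <= t0 by apply: sup_upper_bound => //; split => //; lra.
  by lra.
have ht0 : h t0 = c.
  apply/eqP; rewrite eq_le; apply/andP; split; rewrite leNgt; apply/negP => hc.
    have : \forall s \near t0, c < h s by have /cvgr_gt := ct0; exact.
    move=> /nbhs_ballP[e /= e0 he].
    have [t [/andP[t0' t1'] htc] ht] := sup_adherent e0 hE.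
    have tt0 : t <= t0 by apply: sup_upper_bound => //; split => //; lra.
    suff : c < h t by lra.
    by apply: he; rewrite -ball_normE /= ger0_norm; rewrite -/t0 in ht; lra.
  have t01' : t0 < 1.
    by rewrite lt_neqAle t01 andbT; apply/eqP => t1; move: hc; rewrite t1 /c; lra.
  have : \forall s \near t0, h s < c by have /cvgr_lt := ct0; exact.
  move=> /nbhs_ballP[e /= e0 he].
  pose d := Num.min (e / 2) (1 - t0).
  have d0 : 0 < d by rewrite lt_min; apply/andP; split; lra.
  have de : d <= e / 2 by rewrite ge_min lexx.
  have d1 : d <= 1 - t0 by rewrite ge_min lexx orbT.
  have := above (t0 + d); have := he (t0 + d).
  rewrite -ball_normE /= opprD addrA subrr sub0r normrN gtr0_norm // => h1 h2.
  have {}h1 : h (t0 + d) < c by apply: h1; lra.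
  by have : c < h (t0 + d) by [apply: h2; lra]; lra.
exists t0; split.
- rewrite t00 lt_neqAle t01 andbT /=; apply/eqP => t1.
  by move: ht0; rewrite t1 /c; lra.
- by rewrite ht0 /c; lra.
- by move=> t /above; rewrite ht0.
Qed.

Section Minimizers.
Context {R : realType} {n : nat}.
Implicit Types (p z y v x u : 'rV[R]_n) (t s : R).
Context (f : 'rV[R]_n -> R) (D r : R).
Local Notation X := (minimizers f).
Context (D0 : 0 < D) (r0 : 0 < r).
Context (fcont : forall p z, X p -> enorm (z - p) < D ->
  f t @[t --> z] --> f z).
(** The bound r on the inverse condition number, near X. *)
Context (fcone : forall p z u y, X p -> enorm (z - p) < D -> ~ X z ->
  clarke_subdiff f z u -> u != 0 -> X y ->
  r * (enorm u * enorm (z - y)) <= dotv u (z - y)).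

Lemma not_minimizer p x : X p -> ~ X x <-> f p < f x.
Proof.
move=> Xp; split=> [nXx|px Xx]; last by have := Xx p; lra.
by rewrite ltNge; apply/negP => xp; apply: nXx => y; exact: le_trans (Xp y).
Qed.

(** The hypothesis on v says that v is within r s |c| of -s c, where
    c = p + t v - y points away from y.  A subgradient u satisfies
    <u, c> >= r |u| |c|, hence <u, v> < 0: f cannot increase along the
    segment.  Strictness makes the condition stable under perturbation, which
    matters because the mean value inequality only gives a point near the
    segment. *)
Lemma minimizers_shift p y v : X p -> X y -> enorm v < D ->
  (forall t : R, 0 <= t <= 1 -> exists2 s, 0 <= s &
     enorm (v + s *: (p + t *: v - y)) < s * r * enorm (p + t *: v - y)) ->
  X (p + v).
Proof.
move=> Xp Xy vD dir; apply: contrapT => /(not_minimizer _ _ Xp) fpv.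
have segD t : 0 <= t <= 1 -> enorm (p + t *: v - p) < D.
  move=> /andP[t0 t1]; rewrite addrC addKr enormZ ger0_norm //.
  by apply: le_lt_trans vD; rewrite ler_piMl ?enorm_ge0.
have cvg_line t : (fun s : R => p + s *: v) @ t --> p + t *: v.
  apply: (@cvgD _ _ _ (nbhs t)); first exact: (@cvg_cst _ p _ (nbhs t)).
  apply: (@cvgZr_tmp _ _ _ (nbhs t)); exact: cvg_id.
have [t t01 | |t0 [/andP[t00 t01] h0 h1]] :=
  last_crossing _ (fun t => f (p + t *: v)).
- exact: (cvg_comp _ _ (cvg_line t) (fcont _ _ Xp (segD _ t01))).
- by rewrite scale0r addr0 scale1r.
rewrite scale0r addr0 in h0.
set x := p + t0 *: v in h0 h1.
have [|s s0 xs] := dir t0; first by rewrite t00 ltW.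
have xD : enorm (x - p) < D by apply: segD; rewrite t00 ltW.
have [e e0 he] : exists2 e : R, 0 < e & forall z, enorm (z - x) < e ->
    [/\ enorm (z - p) < D, f p < f z &
     enorm (v + s *: (z - y)) < s * r * enorm (z - y)].
  apply: nbhs_eball; near=> z; split; near: z.
  - have : enorm (z - p) @[z --> x] --> enorm (x - p).
      apply: (@cvg_enorm _ _ _ (nbhs x) _ (fun z => z - p)).
      by apply: (@cvgB _ _ _ (nbhs x)); [exact: cvg_id|exact: cvg_cst].
    by move=> /cvgr_lt; exact.
  - by have /cvgr_gt := fcont _ _ Xp xD; exact.
  - have cy : (fun z => z - y) @ x --> x - y.
      by apply: (@cvgB _ _ _ (nbhs x)); [exact: cvg_id|exact: cvg_cst].
    have : s * r * enorm (z - y) - enorm (v + s *: (z - y)) @[z --> x] -->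
      s * r * enorm (x - y) - enorm (v + s *: (x - y)).
      apply: (@cvgB _ _ _ (nbhs x)).
        apply: (@cvgM _ _ (nbhs x)); first exact: cvg_cst.
        exact: (@cvg_enorm _ _ _ (nbhs x) _ (fun z => z - y)).
      apply: (@cvg_enorm _ _ _ (nbhs x) _ (fun z => v + s *: (z - y))).
      by apply: (@cvgD _ _ _ (nbhs x)); [exact: cvg_cst|exact: cvgZl_tmp].
    move=> /cvgr_gt /(_ 0); rewrite subr_gt0 => /(_ xs).
    by apply: filterS => z; rewrite subr_gt0.
pose d := Num.min (1 - t0) (e / (4 * (enorm v + 1))).
have ve := enorm_ge0 v.
have d0 : 0 < d by rewrite lt_min subr_gt0 t01 divr_gt0 //; lra.
have d1 : d <= 1 - t0 by rewrite ge_min lexx.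
have dv : d * (4 * (enorm v + 1)) <= e.
  by rewrite -ler_pdivlMr ?ge_min ?lexx ?orbT //; lra.
have qx : x + d *: v = p + (t0 + d) *: v by rewrite /x scalerDl addrA.
have [] := @subdiff_mean_value _ _ f (f p) (e / 2) x (x + d *: v) Xp.
- move=> z ze; apply: (fcont _ _ Xp).
  by have [|//] := he z; lra.
- by rewrite addrC addKr enormZ gtr0_norm //; nra.
- by rewrite qx; apply: h1; lra.
move=> z [u [zx fu]]; rewrite addrC addKr dotvZr pmulr_rgt0 // => uv.
have [|zD fz zs] := he z; first by lra.
have u0 : u != 0 by apply: contraTneq uv => ->; rewrite dotv0l ltxx.
have := fcone _ _ _ _ Xp zD ((not_minimizer _ _ Xp).2 fz) fu u0 Xy.
have := dotv_le_enorm u (v + s *: (z - y)).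
rewrite dotvDr dotvZr -enorm_gt0 in u0 * => h2 h3.
nra.
Unshelve. all: by end_near. Qed.

(** The restriction t < 1 leaves room for the small angle at every point of the
    segment; t = 1 would end at y, where directions towards y degenerate. *)
Lemma minimizers_toward p y t : X p -> X y -> 0 <= t < 1 ->
  t * enorm (y - p) < D -> X (p + t *: (y - p)).
Proof.
move=> Xp Xy /andP[t0 t1] tD.
have [->|py] := eqVneq y p; first by rewrite subrr scaler0 addr0.
have [->|tn0] := eqVneq t 0; first by rewrite scale0r addr0.
apply: (@minimizers_shift p y) => //; first by rewrite enormZ ger0_norm.
move=> s /andP[s0 s1]; have st : 0 < 1 - s * t by nra.
exists (t / (1 - s * t)); first by rewrite divr_ge0 // ltW.
have -> : p + s *: (t *: (y - p)) - y = - (1 - s * t) *: (y - p).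
  by apply/rowP => i; rewrite !mxE; ring.
rewrite scalerA mulrN divfK ?gt_eqF // -scalerDl subrr scale0r enorm0.
rewrite !mulr_gt0 ?invr_gt0 // ?lt_def ?tn0 //.
rewrite -lt_def enormZ mulr_gt0 ?normr_gt0 ?oppr_eq0 ?gt_eqF //.
by rewrite enorm_gt0 subr_eq0.
Qed.

Lemma shorter_perturbation (a b : 'rV[R]_n) :
  (3 + r) * enorm b <= r * enorm a -> enorm b <= enorm a.
Proof.
move=> ba; rewrite leNgt; apply/negP => ab.
have : 0 < r * (enorm b - enorm a) by apply: mulr_gt0; rewrite ?subr_gt0.
by have := enorm_ge0 b; lra.
Qed.

(** Going half of the way to z, one may deviate sideways by a fixed fraction
    r / (3 + r) of the distance: at time t the velocity is s (b - c) with
    s = 1 / (2 - t) and c the current displacement from z, and |b| < r |c|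
    because |c| >= (|a| - |b|) / 2. *)
Lemma minimizers_halfway z a b : X z -> X (z + a) -> enorm a < D ->
  a != 0 -> (3 + r) * enorm b <= r * enorm a -> X (z + 2^-1 *: (a + b)).
Proof.
move=> Xz Xa aD an0 ba.
have a0 : 0 < enorm a by rewrite enorm_gt0.
have b0 := enorm_ge0 b.
have ba' := shorter_perturbation _ _ ba.
have -> : z + 2^-1 *: (a + b) = z + a + 2^-1 *: (b - a).
  by rewrite -addrA; congr (_ + _); apply/rowP => i; rewrite !mxE; field.
apply: (@minimizers_shift _ z) => //.
  rewrite enormZ gtr0_norm ?invr_gt0 //.
  by have := enormD b (- a); rewrite enormN; lra.
move=> t /andP[t0 t1]; have t2 : 0 < 2 - t by lra.
exists (2 - t)^-1; first by rewrite invr_ge0 ltW.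
set c := z + a + _ - z.
have ce : 2^-1 *: (b - a) + (2 - t)^-1 *: c = (2 - t)^-1 *: b.
  by apply/rowP => i; rewrite /c !mxE; field; rewrite gt_eqF.
rewrite ce enormZ gtr0_norm ?invr_gt0 // -mulrA ltr_pM2l ?invr_gt0 //.
have : (1 - t / 2) * enorm a <= enorm c + t / 2 * enorm b.
  have -> : (1 - t / 2) * enorm a = enorm (c + - (t / 2) *: b).
    rewrite -[X in X * _]gtr0_norm; last by lra.
    by rewrite -enormZ; congr enorm; apply/rowP => i; rewrite /c !mxE; field.
  apply: le_trans (enormD _ _) _.
  by rewrite scaleNr enormN enormZ ger0_norm ?lexx //; lra.
move=> ca.
have c1 : r * ((enorm a - enorm b) / 2) <= r * enorm c by rewrite ler_pM2l //; nra.
have ra : 0 < r * enorm a by rewrite mulr_gt0.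
have [b1|b1] := leP (enorm b) 0.
  by have -> : enorm b = 0 by [lra]; nra.
lra.
Qed.

Lemma minimizers_closed : closed X.
Proof.
move=> z clz y; rewrite leNgt; apply/negP => yz.
have [p [Xp pz]] := clz _ (eball_nbhs z D D0).
rewrite /= enormB in pz.
have /cvgr_gt /(_ _ yz) /clz [q [Xq qy]] := fcont _ _ Xp pz.
by have := Xq y; rewrite leNgt qy.
Qed.

Lemma nearest_minimizer x : X !=set0 ->
  exists2 z, X z & forall y, X y -> enorm (x - z) <= enorm (x - y).
Proof.
move=> [y Xy].
pose A := [set z | enorm (z - x) <= enorm (y - x)] `&` X.
have cA : compact A.
  by apply: compact_closedI; [exact: eball_compact|exact: minimizers_closed].
have A0 : A !=set0 by exists y; split => /=.
have [|z /set_mem[_ Xz] zmin] :=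
    compact_EVT_min (f := fun z => enorm (z - x)) A0 cA.
  apply: continuous_subspaceT => z.
  apply: (@cvg_enorm _ _ _ (nbhs z) _ (fun z => z - x)).
  by apply: (@cvgB _ _ _ (nbhs z)); [exact: cvg_id|exact: cvg_cst].
exists z => // y' Xy'; rewrite !(enormB x).
have [yy'|/ltW yy'] := leP (enorm (y' - x)) (enorm (y - x)).
  by apply: zmin; exact/mem_set.
by apply: le_trans yy'; apply: zmin; apply/mem_set; split => /=.
Qed.

(** Otherwise a short move from z towards y, which stays in X, would come
    closer to x. *)
Lemma nearest_minimizer_obtuse x z y : X z ->
  (forall y, X y -> enorm (x - z) <= enorm (x - y)) -> X y ->
  dotv (y - z) (x - z) <= 0.
Proof.
move=> Xz zmin Xy; rewrite leNgt; apply/negP => yz.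
set a := y - z in yz *; set v := x - z in yz *.
have a0 := enorm_ge0 a; have aa := dotv_ge0 a.
pose t := Num.min (2^-1)
  (Num.min (D / (2 * (enorm a + 1))) (dotv a v / (dotv a a + 1))).
have t0 : 0 < t by rewrite !lt_min invr_gt0 ltr0n !divr_gt0 //; lra.
have t1 : t <= 2^-1 by rewrite ge_min lexx.
have t2 : t * (2 * (enorm a + 1)) <= D.
  by rewrite -ler_pdivlMr ?ge_min ?lexx ?orbT //; lra.
have t3 : t * (dotv a a + 1) <= dotv a v.
  by rewrite -ler_pdivlMr ?ge_min ?lexx ?orbT //; lra.
have /zmin : X (z + t *: a).
  by apply: minimizers_toward => //; rewrite -/a; nra.
rewrite ler_enorm ?enorm_ge0 // enorm_sqr opprD addrA -/v.
clearbody a v.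
by rewrite dotv_sqrD !(dotvNl, dotvNr, dotvZl, dotvZr) (dotvC v); nra.
Qed.

(** * Shape of the set of minimizers *)

(** If x lies between y and y' and z is nearest to x, a convex combination of
    the obtuse angles at y and y' reads |x - z|^2 <= 0. *)
Lemma minimizers_convex y y' t : X y -> X y' -> 0 <= t <= 1 ->
  X (y + t *: (y' - y)).
Proof.
move=> Xy Xy' /andP[t0 t1]; set x := y + _.
have [z Xz zmin] := nearest_minimizer x (ex_intro _ _ Xy).
have h := nearest_minimizer_obtuse x z y Xz zmin Xy.
have h' := nearest_minimizer_obtuse x z y' Xz zmin Xy'.
suff : x - z == 0 by rewrite subr_eq0 => /eqP ->.
rewrite -enorm_eq0 -sqrf_eq0 eq_le sqr_ge0 andbT enorm_sqr.
have -> : dotv (x - z) (x - z) =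
    (1 - t) * dotv (y - z) (x - z) + t * dotv (y' - z) (x - z).
  by rewrite -!dotvZl -dotvDl; congr dotv; apply/rowP => i; rewrite !mxE; ring.
nra.
Qed.

(** Put v = x - z.  A minimizer z + w + c v with w orthogonal to v and nonzero
    can be moved by minimizers_halfway, each time halving and tilting towards
    v.  After j moves the displacement from z is 2^-j (w + (c + j e) v), with
    the same e > 0 at each move because the allowed tilt is a fixed fraction of
    |w|.  Once c + j e > 0 this contradicts nearest_minimizer_obtuse. *)
Lemma no_sideways_minimizer x z w (c : R) : X z ->
  (forall y, X y -> enorm (x - z) <= enorm (x - y)) -> x != z ->
  dotv w (x - z) = 0 -> w != 0 -> enorm (w + c *: (x - z)) < D ->
  ~ X (z + (w + c *: (x - z))).
Proof.
move=> Xz zmin xz; rewrite -subr_eq0 in xz.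
have := fun y => nearest_minimizer_obtuse x z y Xz zmin.
move: (x - z) xz => v v0 obtuse wv w0 aD Xa {zmin x}.
have v1 : 0 < enorm v by rewrite enorm_gt0.
have w1 : 0 < enorm w by rewrite enorm_gt0.
pose e := r * enorm w / ((3 + r) * enorm v).
have e0 : 0 < e by rewrite divr_gt0 ?mulr_gt0 ?addr_gt0.
have ev : (3 + r) * (e * enorm v) = r * enorm w.
  by rewrite /e; field; rewrite !gt_eqF ?addr_gt0.
have wle (d : R) : enorm w <= enorm (w + d *: v).
  rewrite ler_enorm ?enorm_ge0 // enorm_sqr dotv_sqrD !(dotvZl, dotvZr) wv.
  by have := dotv_ge0 v; have := sqr_ge0 d; nra.
have step (j : nat) : let a := 2^-1 ^+ j *: (w + (c + j%:R * e) *: v) in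
    X (z + a) /\ enorm a < D.
  elim: j => [|j /= [Xj jD]]; first by rewrite expr0 mul0r addr0 scale1r.
  set k : R := 2^-1 ^+ j in Xj jD *.
  have k0 : 0 < k by rewrite exprn_gt0 ?invr_gt0.
  set a := w + _ in Xj jD.
  have -> : 2^-1 ^+ j.+1 *: (w + (c + j.+1%:R * e) *: v) =
      2^-1 *: (k *: a + (k * e) *: v).
    by rewrite exprS /k /a -natr1; apply/rowP => i; rewrite !mxE; ring.
  have wa : enorm w <= enorm a by exact: wle.
  have vE : enorm ((k * e) *: v) = k * (e * enorm v).
    by rewrite enormZ gtr0_norm -?mulrA // mulr_gt0.
  have aE : enorm (k *: a) = k * enorm a by rewrite enormZ gtr0_norm.
  have small : (3 + r) * enorm ((k * e) *: v) <= r * enorm (k *: a).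
    by rewrite vE aE !(mulrCA _ k) ler_pM2l // ev ler_pM2l.
  split.
    apply: minimizers_halfway => //.
    by rewrite scaler_eq0 gt_eqF //= -enorm_gt0; lra.
  rewrite enormZ gtr0_norm ?invr_gt0 //.
  have := shorter_perturbation _ _ small; rewrite aE.
  have := enormD (k *: a) ((k * e) *: v); rewrite -/k in jD.
  rewrite enormZ (gtr0_norm k0) in jD; rewrite aE; lra.
pose j := Num.bound (`|c| / e).
have [/= /obtuse + _] := step j.
rewrite addrC addKr dotvZl dotvDl wv add0r dotvZl -enorm_sqr leNgt => /negP.
apply.
have : `|c| / e < j%:R by apply: archi_boundP; rewrite divr_ge0 // ltW.
rewrite ltr_pdivrMr // => cj.
have := ler_norm (- c); rewrite normrN => cN.
by rewrite !mulr_gt0 ?exprn_gt0 ?invr_gt0 //; lra.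
Qed.

Lemma orthogonal_vector v : (2 <= n)%N -> exists2 w, w != 0 & dotv w v = 0.
Proof.
move=> n2; have i0 : (0 < n)%N by exact: ltn_trans n2.
pose i := Ordinal i0; pose j := Ordinal n2.
have dotd k : dotv (delta_mx ord0 k) v = v ord0 k.
  rewrite /dotv (bigD1 k) //= mxE !eqxx mul1r big1 ?addr0 // => l lk.
  by rewrite mxE (negbTE lk) mul0r.
have [vi0|vi0] := eqVneq (v ord0 i) 0.
  exists (delta_mx ord0 i); last by rewrite dotd.
  by apply/eqP => /rowP /(_ i) /eqP; rewrite !mxE !eqxx oner_eq0.
exists (v ord0 j *: delta_mx ord0 i - v ord0 i *: delta_mx ord0 j).
  apply/eqP => /rowP /(_ j) /eqP; rewrite !mxE !eqxx /=.
  by rewrite mulr0 add0r mulr1 oppr_eq0 (negbTE vi0).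
by rewrite dotvDl dotvNl !dotvZl !dotd mulrC subrr.
Qed.

(** The direction of a second minimizer seen from z may be exactly opposite to
    x - z, and then there is nothing to tilt; in dimension at least two, one
    move in a direction b orthogonal to x - z restores no_sideways_minimizer. *)
Lemma minimizers_full y1 y2 x : (2 <= n)%N -> X y1 -> X y2 -> y1 != y2 -> X x.
Proof.
move=> n2 Xy1 Xy2 y12.
have [z Xz zmin] := nearest_minimizer x (ex_intro _ _ Xy1).
have [->//|xz] := eqVneq x z.
have [y Xy yz] : exists2 y, X y & y != z.
  have [y1z|] := eqVneq y1 z; last by exists y1.
  by exists y2; rewrite // -y1z eq_sym.
have nosideways w c := no_sideways_minimizer x z w c Xz zmin xz.
move: (x - z) (subr_eq0 x z) nosideways => v; rewrite (negbTE xz) => /negbT v0 nosw.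
have vv : 0 < dotv v v by rewrite -enorm_sqr exprn_gt0 // enorm_gt0.
have yz1 : 0 < enorm (y - z) by rewrite enorm_gt0 subr_eq0.
pose t := Num.min (2^-1) (D / (2 * enorm (y - z))).
have t0 : 0 < t by rewrite lt_min invr_gt0 ltr0n divr_gt0 ?mulr_gt0.
have t1 : t <= 2^-1 by rewrite ge_min lexx.
have tD : t * (2 * enorm (y - z)) <= D.
  by rewrite -ler_pdivlMr ?mulr_gt0 // ge_min lexx orbT.
have ty : 0 < t * enorm (y - z) by exact: mulr_gt0.
have Xa : X (z + t *: (y - z)) by apply: minimizers_toward => //; lra.
have aD : enorm (t *: (y - z)) < D by rewrite enormZ gtr0_norm //; lra.
have a0 : t *: (y - z) != 0 by rewrite scaler_eq0 gt_eqF //= subr_eq0.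
move: (t *: _) Xa aD a0 => a Xa aD a0.
pose c := dotv a v / dotv v v; pose w := a - c *: v.
have aE : a = w + c *: v by rewrite subrK.
have wv : dotv w v = 0 by rewrite dotvDl dotvNl dotvZl divfK ?gt_eqF // subrr.
have [w0|w0] := eqVneq w 0; last by case: (nosw w c wv w0); rewrite -aE.
have [b b0 bv] := orthogonal_vector v n2.
have b1 : 0 < enorm b by rewrite enorm_gt0.
have a1 : 0 < enorm a by rewrite enorm_gt0.
pose k := r * enorm a / ((3 + r) * enorm b).
have k0 : 0 < k by rewrite divr_gt0 ?mulr_gt0 ?addr_gt0.
have small : (3 + r) * enorm (k *: b) = r * enorm a.
  by rewrite enormZ gtr0_norm // /k; field; rewrite !gt_eqF ?addr_gt0.
clearbody k; have kb0 := enorm_ge0 (k *: b).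
have := nosw (2^-1 *: (k *: b)) (2^-1 * c).
rewrite !dotvZl bv !mulr0 !scaler_eq0 invr_eq0 pnatr_eq0 (gt_eqF k0).
rewrite (negbTE b0).
rewrite -scalerA -scalerDr; have -> : c *: v = a by rewrite aE w0 add0r.
case=> //.
  rewrite enormZ gtr0_norm ?invr_gt0 //.
  have := shorter_perturbation a (k *: b); rewrite small => /(_ (lexx _)).
  by have := enormD (k *: b) a; lra.
rewrite [k *: b + a]addrC; apply: minimizers_halfway => //.
by rewrite small.
Qed.

End Minimizers.

(** * The distance sublevel set *)

Section Sublevel.
Context {R : realType} {n : nat}.
Implicit Types (X : set 'rV[R]_n) (x y z : 'rV[R]_n).

Lemma dist_set_le X x y : X y -> (dist_set x X <= (enorm (x - y))%:E)%E.
Proof. by move=> Xy; apply: ereal_inf_lbound; exists y. Qed.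

Lemma dist_setE X x : X !=set0 -> dist_set x X = (fine (dist_set x X))%:E.
Proof.
move=> [y Xy]; rewrite fineK // ge0_fin_numE.
  exact: le_lt_trans (dist_set_le _ _ _ Xy) (ltry _).
by apply: le_ereal_inf_tmp => _ [z _ <-]; rewrite lee_fin enorm_ge0.
Qed.

Lemma fine_dist_set_ge0 X x : 0 <= fine (dist_set x X).
Proof.
rewrite fine_ge0 //.
by apply: le_ereal_inf_tmp => _ [z _ <-]; rewrite lee_fin enorm_ge0.
Qed.

(** The infimum defining a distance need not be attained, so membership is
    phrased with approximate nearest points. *)
Lemma dist_sublevelP X x0 x : X !=set0 -> dist_sublevel X x0 x <->
  forall eps, 0 < eps ->
    exists2 y, X y & enorm (x - y) <= fine (dist_set x0 X) + eps.
Proof.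
move=> X0; rewrite /dist_sublevel /= (dist_setE _ x0 X0); split.
  move=> xD eps eps0.
  have : (dist_set x X < (fine (dist_set x0 X) + eps)%:E)%E.
    by apply: le_lt_trans xD _; rewrite lte_fin ltrDl.
  by move=> /ereal_inf_lt [_ [y Xy <-]]; rewrite lte_fin => /ltW; exists y.
move=> near; apply/lee_addgt0Pr => eps /near [y Xy].
by rewrite -lee_fin; apply: le_trans; exact: dist_set_le.
Qed.

Lemma near_dist_sublevel X x0 x p : X p ->
  enorm (x - p) <= fine (dist_set x0 X) -> dist_sublevel X x0 x.
Proof.
move=> Xp xp; apply/dist_sublevelP; first by exists p.
by move=> eps eps0; exists p; rewrite // ler_wpDr // ltW.
Qed.

Lemma dist_minimizers_gt0 (f : 'rV[R]_n -> R) x : minimizers f !=set0 ->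
  f z @[z --> x] --> f x -> ~ minimizers f x ->
  0 < fine (dist_set x (minimizers f)).
Proof.
move=> X0 cf nXx; rewrite lt_def fine_dist_set_ge0 andbT; apply/eqP => d0.
apply: nXx => y; rewrite leNgt; apply/negP => yx.
have /cvgr_gt /(_ _ yx) /nbhs_eball [e e0 he] := cf.
have /(dist_sublevelP _ x x X0) : dist_sublevel (minimizers f) x x by exact: lexx.
move=> /(_ (e / 2)) []; first by rewrite divr_gt0.
move=> z Xz; rewrite d0 add0r enormB => zx.
have : f y < f z by apply: he; lra.
by rewrite ltNge Xz.
Qed.

End Sublevel.

(** * One step of the method *)

Section Contraction.
Context {R : realType}.

(** On [0, a] the convex function e |-> e^2 - 2 s r e lies below the chord
    e |-> e (a - 2 s r), which is at most its value at e = a or e = 0 according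
    to the sign of a - 2 s r.  At e = a the lower bound on s is used, at e = 0
    the upper one. *)
Lemma step_quadratic_bound (beta r a e s : R) : 0 < beta -> beta <= 1 / 2 ->
  0 < r -> r <= 1 -> 0 <= e <= a -> beta * (r * a) <= s <= (1 - beta) * (r * a) ->
  e ^+ 2 - 2 * s * r * e + s ^+ 2 <=
    (1 + (beta ^+ 2 - 2 * beta) * r ^+ 2) * a ^+ 2.
Proof.
move=> b0 b1 r0 r1 /andP[e0 ea] /andP[s1 s2].
have a0 : 0 <= a by exact: le_trans ea.
have ra : 0 <= r * a by rewrite mulr_ge0 // ltW.
have chord : e ^+ 2 - 2 * s * r * e <= e * (a - 2 * s * r) by nra.
have [big|small] := leP (2 * s * r) a.
  have c1 : e * (a - 2 * s * r) <= a * (a - 2 * s * r).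
    by rewrite ler_wpM2r // subr_ge0.
  have c2 : 0 <= (s - beta * (r * a)) * (2 * (r * a) - s - beta * (r * a)).
    by rewrite mulr_ge0 //; nra.
  nra.
have c1 : e * (a - 2 * s * r) <= 0 by nra.
have s0 : 0 <= s by apply: le_trans s1; rewrite mulr_ge0 // ltW.
have c2 : s ^+ 2 <= ((1 - beta) * (r * a)) ^+ 2.
  by rewrite ler_pXn2r ?nnegrE ?mulr_ge0 //; lra.
have c3 : r ^+ 2 * a ^+ 2 <= a ^+ 2 by rewrite ler_piMl ?sqr_ge0 // expr_le1 // ltW.
nra.
Qed.

Lemma decay_sqr (beta r : R) t : 0 <= 1 + (beta ^+ 2 - 2 * beta) * r ^+ 2 ->
  decay beta r t ^+ 2 = (1 + (beta ^+ 2 - 2 * beta) * r ^+ 2) ^+ t.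
Proof.
move=> q0; rewrite /decay -powR_mulrn ?powR_ge0 // -powRrM divfK //.
by rewrite powR_mulrn.
Qed.

Lemma subgradient_step {n : nat} (x y g : 'rV[R]_n) (r s : R) :
  g != 0 -> 0 <= s ->
  r * (enorm g * enorm (x - y)) <= dotv g (x - y) ->
  enorm (x - (s / enorm g) *: g - y) ^+ 2 <=
    enorm (x - y) ^+ 2 - 2 * s * r * enorm (x - y) + s ^+ 2.
Proof.
rewrite -enorm_gt0 addrAC; move: (x - y) => d g0 s0 cone.
have kg : s / enorm g * enorm g = s by rewrite divfK ?gt_eqF.
have k0 : 0 <= s / enorm g by rewrite divr_ge0 // ltW.
move: (s / enorm g) kg k0 => k kg k0.
have dE : dotv (d - k *: g) (d - k *: g) =
    enorm d ^+ 2 - 2 * (k * dotv g d) + s ^+ 2.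
  by rewrite -kg exprMn !enorm_sqr !dotvE (dotvC d g); ring.
rewrite enorm_sqr dE; have := ler_wpM2l k0 cone.
have -> : k * (r * (enorm g * enorm d)) = s * r * enorm d by rewrite -kg; ring.
by lra.
Qed.

End Contraction.

(** * Steps on a line *)

Section Line.
Context {R : realType}.

(** P is an interval to the left of a, and a step of length s to the left may
    jump over it.  In that case b and a point y of P almost nearest to a0 both
    lie between a - s and a; the one closer to a - s is at distance at most
    s - |y - b| <= |a0 - b| - |y - b| <= |a0 - y| from it. *)
Lemma overshoot_bound (P : set R) (D a a0 b s : R) : 0 <= D ->
  (forall y y' t, P y -> P y' -> y <= t <= y' -> P t) ->
  P b -> (forall y, P y -> y < a) ->
  (forall eps, 0 < eps -> exists2 y, P y & `|a - y| <= D + eps) ->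
  (forall eps, 0 < eps -> exists2 y, P y & `|a0 - y| <= D + eps) ->
  0 <= s <= `|a0 - b| ->
  forall eps, 0 < eps -> exists2 y, P y & `|a - s - y| <= D + eps.
Proof.
move=> D0 cvx Pb Pa aD a0D /andP[s0 sb] eps eps0.
have [y Py ya] := aD eps eps0.
have [le1|] := pselect (forall y, P y -> y <= a - s).
  exists y => //; have := le1 _ Py; have := Pa _ Py => h1 h2.
  by have := ler_norm (a - y); rewrite [`|a - s - y|]ger0_norm; lra.
move=> /existsNP [y0 /not_implyP [Py0 /negP]]; rewrite -ltNge => ay0.
have [[y1 Py1 y1a]|none] := pselect (exists2 y1, P y1 & y1 <= a - s).
  exists (a - s); last by rewrite subrr normr0; lra.
  by apply: (cvx y1 y0) => //; rewrite y1a ltW.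
have gt1 z : P z -> a - s < z.
  by move=> Pz; rewrite ltNge; apply/negP => za; apply: none; exists z.
have {ya Py y} [y Py ya] := a0D eps eps0.
have := gt1 _ Py; have := gt1 _ Pb.
have := Pa _ Py; have := Pa _ Pb => h1 h2 h3 h4.
have tri : `|a0 - b| <= `|a0 - y| + `|y - b| by exact: ler_distD.
have [yb|yb] := leP y b.
  exists y => //; move: tri; rewrite [`|y - b|]ler0_norm; last by lra.
  by rewrite [`|a - s - y|]ler0_norm; lra.
exists b => //; move: tri; rewrite [`|y - b|]gtr0_norm; last by lra.
by rewrite [`|a - s - b|]ler0_norm; lra.
Qed.

Lemma dotv_dim_le1 {n : nat} (u v : 'rV[R]_n) : (n <= 1)%N ->
  `|dotv u v| = enorm u * enorm v.
Proof.
case: n u v => [|[|//]] u v _.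
  by rewrite /enorm /dotv !big_ord0 sqrtr0 mul0r normr0.
by rewrite /enorm /dotv !big_ord1 -!expr2 !sqrtr_sqr normrM.
Qed.

(** In dimension at most one, |u| = |<g, u>| / |g| for g <> 0, so that
    y |-> <g, y> / |g| is an isometric coordinate that puts all of X to the left
    of x and turns the step into a move to the left. *)
Lemma line_step {n : nat} (X : set 'rV[R]_n) (x0 x xs g : 'rV[R]_n) (s : R) :
  (n <= 1)%N ->
  (forall y y' t, X y -> X y' -> 0 <= t <= 1 -> X (y + t *: (y' - y))) ->
  X xs -> g != 0 -> (forall y, X y -> 0 < dotv g (x - y)) ->
  dist_sublevel X x0 x -> 0 <= s <= enorm (x0 - xs) ->
  dist_sublevel X x0 (x - (s / enorm g) *: g).
Proof.
move=> n1 cvx Xxs g0 gX xS s0.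
have X0 : X !=set0 by exists xs.
rewrite -enorm_gt0 in g0.
pose c y := dotv g y / enorm g.
have cB y z : c (y - z) = c y - c z by rewrite /c dotvDr dotvNr mulrBl.
have cD y z t : c (y + t *: z) = c y + t * c z.
  by rewrite /c dotvDr dotvZr mulrDl mulrA.
have cE y : enorm y = `|c y|.
  rewrite /c normrM dotv_dim_le1 // normfV (gtr0_norm g0).
  by rewrite mulrAC divff ?mul1r // gt_eqF.
have x0S : dist_sublevel X x0 x0 by exact: lexx.
apply/dist_sublevelP => // eps eps0.
have cg : c ((s / enorm g) *: g) = s.
  by rewrite /c dotvZr -enorm_sqr; field; rewrite gt_eqF.
suff [_ [y Xy <-] yD] : exists2 y, (c @` X) y &
    `|c x - s - y| <= fine (dist_set x0 X) + eps.
  by exists y => //; rewrite cE !cB cg.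
apply: (@overshoot_bound _ _ _ (c x0) (c xs)) => //.
- exact: fine_dist_set_ge0.
- move=> _ _ t [y Xy <-] [y' Xy' <-] /andP[yt ty'].
  have [e|ne] := eqVneq (c y) (c y').
    by exists y => //; apply/eqP; rewrite eq_le yt e ty'.
  have d0 : 0 < c y' - c y by rewrite subr_gt0 lt_neqAle ne (le_trans yt).
  exists (y + ((t - c y) / (c y' - c y)) *: (y' - y)).
    apply: cvx => //; rewrite divr_ge0 ?subr_ge0 //=; last exact: le_trans yt ty'.
    by rewrite ler_pdivrMr // mul1r lerD2r.
  by rewrite cD cB divfK ?gt_eqF // addrC subrK.
- by move=> _ [y Xy <-]; rewrite -subr_gt0 -cB divr_gt0 // gX.
- move=> d d0; have [y Xy yd] := (dist_sublevelP _ _ _ X0).1 xS d d0.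
  by exists (c y); [exists y|rewrite -cB -cE].
- move=> d d0; have [y Xy yd] := (dist_sublevelP _ _ _ X0).1 x0S d d0.
  by exists (c y); [exists y|rewrite -cB -cE].
- by rewrite -cB -cE.
Qed.

End Line.

(** * Convergence *)

Lemma cone_condition (R : realType) (n : nat) (f : 'rV[R]_n -> R)
    (x0 x xs u : 'rV[R]_n) (r : R) :
  (r%:E <= inv_condition_number f x0)%E -> minimizers f xs ->
  dist_sublevel (minimizers f) x0 x -> ~ minimizers f x ->
  clarke_subdiff f x u -> u != 0 ->
  r * (enorm u * enorm (x - xs)) <= dotv u (x - xs).
Proof.
move=> hr Xxs Sx nXx fu u0.
have xxs : x != xs by apply: contra_notN nXx => /eqP ->.
rewrite -ler_pdivlMr; last by rewrite mulr_gt0 ?enorm_gt0 ?subr_eq0.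
rewrite -lee_fin; apply: le_trans hr _.
apply: le_trans (ereal_inf_lbound _) _.
  by exists xs => //; exists x => //; reflexivity.
by apply: ereal_inf_lbound; exists u => //; split => //; exact/eqP.
Qed.

Theorem theorem7 (R : realType) (n : nat) (f : 'rV[R]_n -> R)
    (x0 : 'rV[R]_n)
    (hmin : minimizers f !=set0)
    (hlip : locally_lipschitz_over f (dist_sublevel (minimizers f) x0))
    (hmu : (0 < inv_condition_number f x0)%E)
    (xs : 'rV[R]_n) (hxs : minimizers f xs)
    (beta : R) (hbeta0 : 0 < beta) (hbeta : beta <= 1 / 2)
    (radius : R)
    (hradl : beta * enorm (x0 - xs) <= radius)
    (hradr : radius <= (1 - beta) * enorm (x0 - xs))
    (r : R) (hr0 : 0 < r) (hr : (r%:E <= inv_condition_number f x0)%E)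
    (N : nat) (x g : nat -> 'rV[R]_n)
    (hrun : subgradient_run f beta r radius x0 N x g) :
  forall t : nat, (t <= N)%N ->
    enorm (x t - xs) <= decay beta r t * enorm (x0 - xs).
Proof.
case: hrun => xx0 run.
set X := minimizers f in hmin hlip hxs *.
pose D := fine (dist_set x0 X).
have noncrit t : (t < N)%N -> ~ X (x t).
  move=> tN Xt; have [+ _ _] := run _ tN; apply.
  exact: minimizer_clarke_subdiff.
have cont z : dist_sublevel X x0 z -> f t @[t --> z] --> f z.
  by move=> /hlip [U [oU Uz [L fL]]]; exact: (lipschitz_cvg _ _ _ _ oU Uz fL).
have x0S : dist_sublevel X x0 x0 by exact: lexx.
(* Membership in S has to be carried along: the cone condition is only
   available there. *)
suff main t : (t <= N)%N -> dist_sublevel X x0 (x t) /\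
    enorm (x t - xs) <= decay beta r t * enorm (x0 - xs).
  by move=> t /main [].
elim: t => [_|t IH tN].
  by rewrite xx0 /decay mul0r powRr0 mul1r lexx.
have [St xt] := IH (ltnW tN).
have nXt := noncrit _ tN.
have nX0 : ~ X x0 by rewrite -xx0; apply: noncrit; exact: leq_ltn_trans tN.
have D0 : 0 < D by apply: dist_minimizers_gt0 => //; exact: cont.
have [ncrit fg xS] := run _ tN.
have gn0 : g t != 0 by apply: contra_notN ncrit => /eqP <-.
have g0 : 0 < enorm (g t) by rewrite enorm_gt0.
have fcont p z : X p -> enorm (z - p) < D -> f t @[t --> z] --> f z.
  by move=> Xp zp; apply: cont; apply: near_dist_sublevel Xp (ltW zp).
have fcone p z u y : X p -> enorm (z - p) < D -> ~ X z ->
    clarke_subdiff f z u -> u != 0 -> X y ->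
    r * (enorm u * enorm (z - y)) <= dotv u (z - y).
  move=> Xp zp nXz fu u0 Xy; apply: cone_condition hr _ _ nXz fu u0 => //.
  exact: near_dist_sublevel Xp (ltW zp).
have cone y : X y ->
    r * (enorm (g t) * enorm (x t - y)) <= dotv (g t) (x t - y).
  by move=> Xy; exact: cone_condition hr Xy St nXt fg gn0.
have away y : X y -> 0 < enorm (g t) * enorm (x t - y).
  move=> Xy; rewrite mulr_gt0 // enorm_gt0 subr_eq0.
  by apply: contra_notN nXt => /eqP ->.
(* The existence of a nonzero subgradient bounds r through Cauchy-Schwarz. *)
have r1 : r <= 1.
  have := le_trans (cone xs hxs) (dotv_le_enorm _ _).
  by rewrite ger_pMl // away.
set q : R := 1 + (beta ^+ 2 - 2 * beta) * r ^+ 2.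
have rr : r ^+ 2 <= 1 by rewrite expr_le1 // ltW.
have rr0 : 0 <= r ^+ 2 by exact: sqr_ge0.
have q0 : 0 <= q by rewrite /q; nra.
have q1 : q <= 1 by rewrite /q; nra.
have d0 k : 0 <= decay beta r k by exact: powR_ge0.
have d1 k : decay beta r k <= 1.
  rewrite -(@expr_le1 _ 2) // decay_sqr //.
  by rewrite exprn_ile1.
have e0 := enorm_ge0 (x0 - xs).
set s := r * decay beta r t * radius in xS.
have sl : beta * (r * (decay beta r t * enorm (x0 - xs))) <= s.
  rewrite /s.
  have -> : beta * (r * (decay beta r t * enorm (x0 - xs))) =
    r * decay beta r t * (beta * enorm (x0 - xs)) by ring.
  by rewrite ler_wpM2l // mulr_ge0 // ltW.
have sr : s <= (1 - beta) * (r * (decay beta r t * enorm (x0 - xs))).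
  rewrite /s.
  have -> : (1 - beta) * (r * (decay beta r t * enorm (x0 - xs))) =
    r * decay beta r t * ((1 - beta) * enorm (x0 - xs)) by ring.
  by rewrite ler_wpM2l // mulr_ge0 // ltW.
have de0 : 0 <= decay beta r t * enorm (x0 - xs) by exact: mulr_ge0.
have s0 : 0 <= s by apply: le_trans sl; rewrite !mulr_ge0 // ltW.
have contr : enorm (x t.+1 - xs) <= decay beta r t.+1 * enorm (x0 - xs).
  rewrite -(@ler_pXn2r _ 2) ?nnegrE ?enorm_ge0 ?mulr_ge0 // exprMn decay_sqr // -/q.
  rewrite (exprS q) -mulrA -(decay_sqr _ _ t) // -exprMn xS.
  apply: le_trans (subgradient_step _ _ _ _ _ gn0 s0 (cone xs hxs)) _.
  by apply: step_quadratic_bound; rewrite ?enorm_ge0 // ?sl.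
split => //.
have [n1|n2] := leqP n 1.
  rewrite xS; apply: (line_step _ _ _ xs) => //.
  - exact: (minimizers_convex f D r).
  - by move=> y Xy; apply: lt_le_trans (cone y Xy); rewrite mulr_gt0 // away.
  - rewrite s0 /=; apply: le_trans sr _.
    have h1 : r * (decay beta r t * enorm (x0 - xs)) <= enorm (x0 - xs).
      by rewrite mulrA ler_piMl // mulr_ile1 // ltW.
    by have := mulr_ge0 (ltW hr0) de0; nra.
(* In dimension at least two a second minimizer would make x0 one. *)
have only y : X y -> y = xs.
  move=> Xy; apply/eqP; apply: contra_notT nX0 => yxs.
  exact: (minimizers_full f D r D0 hr0 fcont fcone y xs x0 n2 Xy hxs yxs).
apply/dist_sublevelP => // eps eps0.
have [y Xy yD] := (dist_sublevelP _ _ _ hmin).1 x0S eps eps0.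
exists xs => //; apply: le_trans contr _; apply: le_trans yD.
by rewrite (only y Xy) ler_piMl.
Qed.
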